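(* For every $n\geq 3$, \[ \mathrm{La}(n,N,\#P_2)=\mathrm{La}(n,\mathcal{P}_4,\#P_2)=\binom{n}{\lfloor n/2\rfloor}. \]
   Context: $2^{[n]}$ is the Boolean lattice of all subsets of $[n]=\{1,\dots,n\}$ ordered by inclusion. A poset $P$ is a (weak) subposet of a poset $Q$ if there is an injection $f:P\to Q$ such that $p\le_P p'$ implies $f(p)\le_Q f(p')$. For a poset or a family of posets, a family $\mathcal{F}\subseteq 2^{[n]}$ is free of it if no poset in question is a weak subposet of $(\mathcal{F},\subseteq)$. $P_2$ is the 2-element chain; a copy of $P_2$ in $\mathcal{F}$ is a pair $F\subsetneq F'$ with $F,F'\in\mathcal{F}$. $\mathrm{La}(n,P,\#P_2)$ (where $P$ is a poset or a family of posets) is the maximum number of copies of $P_2$ in a $P$-free family $\mathcal{F}\subseteq 2^{[n]}$. The poset $N$ consists of four distinct elements $p_1,p_2,q_1,q_2$ with $p_1<q_1$, $p_2<q_1$, $p_2<q_2$. $\mathcal{P}_k$ denotes the family of all posets on $k$ elements whose undirected Hasse diagram is a path. *)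

(* Defs.v *)
From HB Require Import structures.
From mathcomp Require Import all_boot all_order.
From mathcomp Require Import boolp.

Set Implicit Arguments.
Unset Strict Implicit.
Unset Printing Implicit Defensive.

Import Order.Theory Order.DefaultSetSubsetOrder.
Local Open Scope order_scope.

Record finPoset := FinPoset {
  finPoset_disp : Order.disp_t;
  finPoset_sort :> finPOrderType finPoset_disp }.

Definition poset_class := finPoset -> Prop.

Definition one_poset (P : finPoset) : poset_class := fun Q => Q = P.

Definition weak_subposet (d d' : Order.disp_t)
    (P : porderType d) (Q : porderType d') : Prop :=
  exists f : P -> Q, injective f /\ forall p p' : P, p <= p' -> f p <= f p'.

(* DefaultSetSubsetOrder orders {set 'I_n} by inclusion. *)
Notation set_family n := {set {set 'I_n}}.

Section FamilyPoset.
Variables (n : nat) (F : set_family n).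

Definition family_poset := {A : {set 'I_n} | A \in F}.

HB.instance Definition _ := Finite.on family_poset.
HB.instance Definition _ := SubType.on family_poset.
HB.instance Definition _ :=
  [SubChoice_isSubPOrder of family_poset by <: with Order.Disp tt tt].

End FamilyPoset.

Definition poset_free (n : nat) (PP : poset_class) (F : set_family n) : Prop :=
  forall P : finPoset, PP P -> ~ weak_subposet P (family_poset F).

Definition num_P2 (n : nat) (F : set_family n) : nat :=
  #|[set AB : {set 'I_n} * {set 'I_n} |
      [&& AB.1 \in F, AB.2 \in F & AB.1 \proper AB.2]]|.

(* If no family is PP-free, the value is 0. *)
Definition La_P2 (n : nat) (PP : poset_class) : nat :=
  (\max_(F : set_family n | `[< poset_free PP F >]) num_P2 F)%N.

Inductive N_elt := N_p1 | N_p2 | N_q1 | N_q2.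

Definition N_elt_ord (x : N_elt) : 'I_4 :=
  match x with
  | N_p1 => inord 0 | N_p2 => inord 1 | N_q1 => inord 2 | N_q2 => inord 3
  end.

Definition N_elt_of_ord (i : 'I_4) : N_elt :=
  match val i with 0 => N_p1 | 1 => N_p2 | 2 => N_q1 | _ => N_q2 end.

Lemma N_elt_ordK : cancel N_elt_ord N_elt_of_ord.
Proof. by case; rewrite /N_elt_of_ord /= inordK. Qed.

HB.instance Definition _ := Finite.copy N_elt (can_type N_elt_ordK).

Definition N_lt (x y : N_elt) : bool :=
  match x, y with
  | N_p1, N_q1 | N_p2, N_q1 | N_p2, N_q2 => true
  | _, _ => false
  end.

Definition N_le (x y : N_elt) : bool := (x == y) || N_lt x y.

Lemma N_lt_def x y : N_lt x y = (y != x) && N_le x y.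
Proof.
by rewrite /N_le eq_sym; case: eqVneq => [->|] //; case: y.
Qed.

Lemma N_le_refl : reflexive N_le.
Proof. by move=> x; rewrite /N_le eqxx. Qed.

Lemma N_le_anti : antisymmetric N_le.
Proof.
move=> x y; rewrite /N_le [y == x]eq_sym.
by case: eqVneq => //=; case: x; case: y.
Qed.

Lemma N_le_trans : transitive N_le.
Proof.
move=> y x z /predU1P[->//|xy] /predU1P[<-|yz]; rewrite /N_le ?xy ?orbT //.
by case: x y z xy yz => [] [] [].
Qed.

HB.instance Definition _ := Order.isPOrder.Build (Order.Disp tt tt) N_elt
  N_lt_def N_le_refl N_le_anti N_le_trans.

Definition poset_N : finPoset := @FinPoset (Order.Disp tt tt) N_elt.

Definition covered_by (d : Order.disp_t) (P : finPOrderType d) (x y : P) : bool :=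
  (x < y) && [forall z : P, ~~ ((x < z) && (z < y))].

Definition hasse_adj (d : Order.disp_t) (P : finPOrderType d) (x y : P) : bool :=
  covered_by x y || covered_by y x.

(* The bijection lists the k elements of P along the path. *)
Definition path_posets (k : nat) : poset_class :=
  fun P => exists f : 'I_k -> P, bijective f /\
    forall i j : 'I_k,
      hasse_adj (f i) (f j) = (i.+1 == j :> nat) || (j.+1 == i :> nat).

(* Main.v *)
(** In an N-free family every component of the comparability graph is a chain
    of three sets, isolated from the rest of the family, or a star.  A star
    with [k] leaves contributes [k] pairs and its leaves form an antichain; a
    three-chain from [A] to [C] contributes 3 pairs and is replaced by the
    whole interval [[A, C]].  These intervals and the leaves are pairwise
    incomparable, so no maximal chain of the Boolean lattice meets two of
    them.  A random maximal chain meets a given leaf with probability at least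
    [1 / 'C(n, n./2)] and a given interval with probability at least
    [3 / 'C(n, n./2)], which gives the upper bound as in the LYM inequality.
    The empty set together with the middle level attains it. *)

Require Import Defs.
From mathcomp Require Import all_boot all_order.
From mathcomp Require Import boolp zify.

Set Implicit Arguments.
Unset Strict Implicit.
Unset Printing Implicit Defensive.

Local Open Scope nat_scope.

(** * Binomial estimates *)

Lemma leq_bin_half n m : 'C(n, m) <= 'C(n, n./2).
Proof.
have incr k : k <= n./2 -> 'C(n, k) <= 'C(n, n./2).
  move=> le_k; have [d ->] : exists d, k = n./2 - d by exists (n./2 - k); lia.
  elim: d => [|d IHd]; first by rewrite subn0.
  have [ltd|] := ltnP d n./2; last first.
    by move=> ?; rewrite (_ : n./2 - d.+1 = n./2 - d) //; lia.
  apply: leq_trans IHd; rewrite (_ : n./2 - d = (n./2 - d.+1).+1); last by lia.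
  set j := n./2 - d.+1; rewrite -(leq_pmul2l (ltn0Sn j)) mul_bin_left.
  by rewrite leq_mul2r; apply/orP; right; rewrite /j; lia.
have [/incr //|lt_m] := leqP m n./2.
have [le_mn|lt_nm] := leqP m n; last by rewrite bin_small.
by rewrite -bin_sub //; apply: incr; lia.
Qed.

(** With [n./2 = h + 1] the ratio of ['C(n, h + 1)] to ['C(n - 2, h)] is [4 - 2 / (h + 1)] for even
    [n] and [4 - 2 / (h + 2)] for odd [n]; it equals 3 at [n = 3] and [n = 4]. *)
Lemma leq_3bin_half n m : 3 <= n -> 3 * 'C(n - 2, m) <= 'C(n, n./2).
Proof.
move=> n_ge3; apply: (@leq_trans (3 * 'C(n - 2, (n - 2)./2))).
  by rewrite leq_mul2l leq_bin_half orbT.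
have [h Dh] : exists h, n./2 = h.+1 by exists (n./2).-1; lia.
have -> : (n - 2)./2 = h by lia.
have D1 : n * 'C(n.-1, h) = h.+1 * 'C(n, h.+1) := mul_bin_diag n h.
have D2 : n.-1 * 'C(n - 2, h) = (n.-1 - h) * 'C(n.-1, h).
  by rewrite -mul_bin_down subn2.
rewrite Dh; move: D1 D2; set x := 'C(n - 2, h); set y := 'C(n.-1, h).
set z := 'C(n, h.+1) => D1 D2.
have D3 : (n * n.-1) * x = ((n.-1 - h) * h.+1) * z.
  by rewrite -!mulnA D2 -D1 mulnCA.
have le3 : 3 * ((n.-1 - h) * h.+1) <= n * n.-1.
  have [Dn|Dn] : n = h.*2 + 2 \/ n = h.*2 + 3 by lia.
    have -> : n.-1 - h = h.+1 by lia.
    have -> : n = h.+1 * 2 by lia.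
    by nia.
  have -> : n.-1 - h = h.+2 by lia.
  have -> : n.-1 = 2 * h.+1 by lia.
  by rewrite !mulnA leq_mul2r; apply/orP; right; lia.
have pos : 0 < (n.-1 - h) * h.+1 by nia.
rewrite -(leq_pmul2l pos) -D3 mulnA [_ * 3]mulnC.
by rewrite leq_mul2r le3 orbT.
Qed.

(** An injective word of length [m] either avoids the new letter or has it in one of [m] places. *)
Lemma ffactS_pascal n m : n.+1 ^_ m = n ^_ m + m * n ^_ m.-1.
Proof.
case: m => [|m]; first by rewrite !ffactn0 mul0n.
rewrite ffactSS ffactnSr /=.
have [le_mn|lt_nm] := leqP m n; last by rewrite ffact_small // !muln0.
by rewrite ![_.+1 * _]mulnC -mulnDr; congr (_ * _); lia.
Qed.

(** * Counting maximal chains that meet a family *)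

(* The number of maximal chains from the empty set to [X], where [#|X| = k],
   that meet [U]. *)
Fixpoint chains_meeting (T : finType) (U : {set {set T}}) (k : nat)
    (X : {set T}) : nat :=
  if X \in U then k`! else
  if k is k'.+1 then \sum_(x in X) chains_meeting U k' (X :\ x) else 0.

Lemma chains_meeting0 (T : finType) (U : {set {set T}}) k (X : {set T}) :
  (forall Y : {set T}, Y \in U -> ~~ (Y \subset X)) -> chains_meeting U k X = 0.
Proof.
elim: k X => [|k IHk] X UX /=.
  by case: ifP => // /UX; rewrite subxx.
case: ifP => [/UX|_]; first by rewrite subxx.
apply: big1 => x _; apply: IHk => Y /UX; apply: contra => /subset_trans; apply.
exact: subsetDl.
Qed.

(** No chain meets two of the families, so each maximal chain is counted at most once. *)
Lemma chains_meeting_sum_le (T I : finType) (J : {set I})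
    (U : I -> {set {set T}}) k (X : {set T}) :
    #|X| = k ->
    {in J &, forall i j Y Z, Y \in U i -> Z \in U j -> Y \subset Z -> i = j} ->
  \sum_(i in J) chains_meeting (U i) k X <= k`!.
Proof.
move=> cX incU; elim: k X cX => [|k IHk] X cX.
all: have [/existsP[i /andP[Ji Xi]]|/existsPn nX] :=
  boolP [exists i, (i \in J) && (X \in U i)].
- rewrite (bigD1 i) //= Xi big1 => [//|j /andP[Jj ji]].
  case: ifP => // Xj; case/eqP: ji.
  by apply: (incU j i _ _ X X).
- rewrite big1 // => i Ji /=.
  by case: ifP => // Xi; case/negP: (nX i); rewrite Ji.
- rewrite (bigD1 i) //= Xi big1 ?addn0 // => j /andP[Jj ji].
  apply: (@chains_meeting0 _ _ k.+1) => Y Yj; apply/negP => YX.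
  by case/eqP: ji; apply: (incU j i _ _ Y X).
rewrite (eq_bigr (fun i => \sum_(x in X) chains_meeting (U i) k (X :\ x))); last first.
  by move=> i Ji /=; case: ifP => // Xi; case/negP: (nX i); rewrite Ji.
rewrite exchange_big /= factS -cX -sum_nat_const leq_sum // => x Xx.
by apply: IHk; move: (cardsD1 x X); rewrite Xx cX => -[].
Qed.

(** A maximal chain is an ordering of [X]. The left side counts the orderings in which, once [B] is
    ignored, [A] comes before the rest; such a chain passes through some [Y] between [A] and
    [A :|: B]. *)
Lemma chains_meeting_interval_ge (T : finType) (U : {set {set T}})
    (A B : {set T}) k (X : {set T}) :
    [disjoint A & B] -> (forall Y : {set T}, A \subset Y -> Y \subset A :|: B -> Y \in U) ->
    #|X| = k -> A \subset X ->
  #|A|`! * #|X :\: (A :|: B)|`! * k ^_ #|X :&: B| <= chains_meeting U k X.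
Proof.
move=> dAB subU; elim: k X => [|k IHk] X cX sAX.
all: have Ek : #|X| = #|A| + #|X :&: B| + #|X :\: (A :|: B)|
  by rewrite -(cardsID (A :|: B) X) setIUr (setIidPr sAX) cardsU
    setIA (setIidPl sAX) (disjoint_setI0 dAB) cards0 subn0.
  move: (Ek); rewrite cX => /esym/eqP; rewrite !addn_eq0.
  move=> /andP[/andP[/eqP A0 /eqP X0] /eqP Y0].
  have XU : X \in U by apply: subU; rewrite // -setD_eq0 -cards_eq0 Y0.
  by rewrite /= XU A0 X0 Y0.
have [XU|nXU] := boolP (X \in U).
  rewrite /= XU.
  have [j Dj] : {j | #|X :&: B| = j} by eexists.
  rewrite -cX Ek Dj; set a := #|A|; set r := #|_ :\: _|.
  rewrite -(@ffact_fact (a + j + r) j); last by lia.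
  rewrite mulnC leq_mul2l (_ : a + j + r - j = a + r); last by lia.
  rewrite -(@bin_fact (a + r) a) ?leq_addr // addKn mulnC.
  by rewrite leq_pmull ?orbT // bin_gt0 leq_addr.
rewrite /= (negPf nXU).
set a := #|A|; set j := #|X :&: B|; set r := #|X :\: (A :|: B)|.
have r_gt0 : 0 < r.
  rewrite lt0n cards_eq0 setD_eq0; apply: contra nXU; exact: subU.
have cXx x : x \in X -> #|X :\ x| = k.
  by move=> Xx; move: (cardsD1 x X); rewrite Xx cX => -[].
(* Split by the last element of the ordering: it lies in [B] or outside [A :|: B], and the terms
   with it in [A] are dropped. *)
rewrite (big_setID B) /= [X in _ + X](big_setID A) /= setDDl [B :|: A]setUC.
apply: (@leq_trans (j * (a`! * r`! * k ^_ j.-1) + r * (a`! * r.-1`! * k ^_ j))).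
  rewrite ffactS_pascal -[in r`!](prednK r_gt0) factS (prednK r_gt0).
  rewrite mulnDr addnC leq_eqVlt; apply/orP; left; apply/eqP.
  by congr (_ + _); nia.
apply: leq_add.
  rewrite -sum_nat_const; apply: leq_sum => x /setIP[Xx Bx].
  have xA : x \notin A by rewrite (disjointFl dAB).
  have := IHk (X :\ x) (cXx x Xx).
  rewrite subsetD1 sAX xA => /(_ isT).
  have -> : (X :\ x) :\: (A :|: B) = X :\: (A :|: B).
    apply/setP=> y; rewrite !inE; case: eqVneq => [->|] //=.
    by rewrite Bx orbT.
  have -> : #|(X :\ x) :&: B| = j.-1.
    rewrite /j (cardsD1 x (X :&: B)) inE Xx Bx /=; congr #|pred_of_set _|.
    by apply/setP=> y; rewrite !inE andbA.
  by [].
apply: leq_trans (leq_addl _ _).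
rewrite -sum_nat_const; apply: leq_sum => x /setDP[Xx].
rewrite inE negb_or => /andP[xA xB].
have := IHk (X :\ x) (cXx x Xx).
rewrite subsetD1 sAX xA => /(_ isT).
have -> : (X :\ x) :&: B = X :&: B.
  apply/setP=> y; rewrite !inE; case: eqVneq => [->|] //=.
  by rewrite (negPf xB) andbF.
have -> : #|(X :\ x) :\: (A :|: B)| = r.-1.
  rewrite /r (cardsD1 x (X :\: (A :|: B))) !inE Xx (negPf xB) (negPf xA) /=.
  by congr #|pred_of_set _|; apply/setP=> y; rewrite !inE andbCA.
by [].
Qed.

Definition interval (T : finType) (A C : {set T}) : {set {set T}} :=
  [set Y : {set T} | (A \subset Y) && (Y \subset C)].

(** Among all orderings of the ground set, those with [A] first outside [B] make up the fraction
    [1 / 'C(n - #|B|, #|A|)]. *)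
Lemma fact_le_chains_meeting_interval n (A B C : {set 'I_n}) :
    [disjoint A & B] -> A :|: B \subset C ->
  n`! <= chains_meeting (interval A C) n setT * 'C(n - #|B|, #|A|).
Proof.
move=> dAB sABC.
have /(_ n setT) := @chains_meeting_interval_ge _ (interval A C) A B _ _ dAB.
have cAB : #|A :|: B| = #|A| + #|B|.
  by rewrite cardsU (disjoint_setI0 dAB) cards0 subn0.
have leAB : #|A| + #|B| <= n by rewrite -cAB -[n in _ <= n]card_ord max_card.
have cC : #|~: (A :|: B)| = n - (#|A| + #|B|).
  by rewrite cardsCs setCK card_ord cAB.
rewrite setTD setTI cardsT card_ord cC => ge.
apply: leq_trans (leq_mul (ge _ _ (subsetT _)) (leqnn _)) => //; last first.
  move=> Y sAY sYAB; rewrite inE sAY; exact: subset_trans sABC.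
rewrite -(@ffact_fact n #|B|); last by lia.
rewrite -(@bin_fact (n - #|B|) #|A|); last by lia.
rewrite (_ : n - #|B| - #|A| = n - (#|A| + #|B|)); last by lia.
by rewrite [X in _ <= X]mulnAC [_ * 'C(_, _)]mulnC [X in _ <= X]mulnC.
Qed.

Lemma chains_meeting_set_ge n (A : {set 'I_n}) :
  n`! <= chains_meeting (interval A A) n setT * 'C(n, n./2).
Proof.
have := @fact_le_chains_meeting_interval n A set0 A.
rewrite disjoints_subset setC0 subsetT setU0 subxx cards0 subn0 => /(_ isT isT).
by move/leq_trans; apply; rewrite leq_mul2l leq_bin_half orbT.
Qed.

(* For [x] in [B :\: A] and [y] in [C :\: B] the interval contains the diamond
   from [A] to [A + x + y]. A maximal chain meets the diamond exactly when
   deleting [x] and [y] from its members yields a chain through [A], an event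
   of probability [1 / 'C(n - 2, #|A|) >= 3 / 'C(n, n./2)]. *)
Lemma chains_meeting_chain3_ge n (A B C : {set 'I_n}) :
    3 <= n -> A \proper B -> B \proper C ->
  3 * n`! <= chains_meeting (interval A C) n setT * 'C(n, n./2).
Proof.
move=> n_ge3 /properP[sAB [x Bx Ax]] /properP[sBC [y Cy By]].
have xy : x != y by apply: contraNneq By => <-.
have Ay : y \notin A by apply: contra By; apply/subsetP.
have := @fact_le_chains_meeting_interval n A [set x; y] C.
rewrite disjoint_sym disjoints_subset !subUset !sub1set !inE Ax Ay cards2 xy /=.
rewrite (subset_trans sAB sBC) Cy (subsetP sBC _ Bx) => /(_ isT isT) le.
apply: leq_trans (leq_mul (leqnn 3) le) _; rewrite mulnCA.
by rewrite leq_mul2l leq_3bin_half ?orbT.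
Qed.

(** * Components of an N-avoiding family *)

Definition P2_pairs n (F : set_family n) : {set {set 'I_n} * {set 'I_n}} :=
  [set AB : {set 'I_n} * {set 'I_n} |
      [&& AB.1 \in F, AB.2 \in F & AB.1 \proper AB.2]].

Definition chain3 n (F : set_family n) (A B C : {set 'I_n}) : bool :=
  [&& A \in F, B \in F, C \in F, A \proper B & B \proper C].

(** The other three of the six pairs are distinct by proper inclusion, so only these coincidences
    can prevent a copy of N. *)
Definition N_avoiding n (F : set_family n) : Prop :=
  forall p1 p2 q1 q2, p1 \in F -> p2 \in F -> q1 \in F -> q2 \in F ->
  p1 \proper q1 -> p2 \proper q1 -> p2 \proper q2 ->
  [\/ p1 = p2, q1 = q2 | p1 = q2].

(** Otherwise [D < C > A < B] is a copy of N. *)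
Lemma chain3_down n (F : set_family n) A B C D :
    N_avoiding F -> chain3 F A B C -> D \in F -> D \proper C ->
  D = A \/ D = B.
Proof.
move=> NF /and5P[FA FB FC AB BC] FD DC.
have [->|CB|->] := NF D A C B FD FA FC FB DC (proper_trans AB BC) AB; auto.
by rewrite CB properxx in BC.
Qed.

(** Otherwise [B < C > A < D] is a copy of N. *)
Lemma chain3_up n (F : set_family n) A B C D :
    N_avoiding F -> chain3 F A B C -> D \in F -> A \proper D ->
  D = B \/ D = C.
Proof.
move=> NF /and5P[FA FB FC AB BC] FD AD.
have [BA|->|->] := NF B A C D FB FA FC FD BC (proper_trans AB BC) AD; auto.
by rewrite BA properxx in AB.
Qed.

(* The interval [I] represents the component of the pair [e]: the hull of a
   three-element chain, or the degenerate interval at a leaf of a star; a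
   component with a single pair is represented by its larger set. *)
Variant represents n (F : set_family n) (e : {set 'I_n} * {set 'I_n}) :
    {set 'I_n} * {set 'I_n} -> Prop :=
| RepChain A B C of chain3 F A B C & e \in [:: (A, B); (B, C); (A, C)] :
    represents F e (A, C)
| RepUpper X of (forall A B C, chain3 F A B C -> X \notin [:: A; B; C])
    & X = e.2 & (forall Y, Y \in F -> Y \proper X -> Y = e.1) :
    represents F e (X, X)
| RepLower X D of (forall A B C, chain3 F A B C -> X \notin [:: A; B; C])
    & X = e.1 & (forall Y, Y \in F -> X \proper Y -> Y = e.2)
    & D \in F & D != X & D \proper e.2 :
    represents F e (X, X).

(** A pair that extends to a three-chain is represented by it. Otherwise neither end lies in a
    three-chain, and the representative is the lower end if the upper one has a further member below
    it, else the upper end. *)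
Lemma represents_exists n (F : set_family n) e :
  N_avoiding F -> e \in P2_pairs F -> exists I, represents F e I.
Proof.
move=> NF; case: e => A B; rewrite inE => /and3P[/= FA FB AB].
have [/existsP[M /and3P[FM AM MB]]|/existsPn nM] :=
    boolP [exists M, [&& M \in F, A \proper M & M \proper B]].
  exists (A, B); apply: (@RepChain _ _ _ A M B); last by rewrite !inE eqxx !orbT.
  by rewrite /chain3 FA FM FB AM.
have [/existsP[M /andP[FM BM]]|/existsPn nU] :=
    boolP [exists M, (M \in F) && (B \proper M)].
  exists (A, M); apply: (@RepChain _ _ _ A B M); last by rewrite !inE eqxx.
  by rewrite /chain3 FA FM FB AB.
have [/existsP[M /andP[FM MA]]|/existsPn nL] :=
    boolP [exists M, (M \in F) && (M \proper A)].
  exists (M, B); apply: (@RepChain _ _ _ M A B); last by rewrite !inE eqxx orbT.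
  by rewrite /chain3 FA FM FB AB MA.
(* A three-chain through [A] would extend the pair, against [nM], [nU] or [nL]. *)
have nA X Y Z : chain3 F X Y Z -> A \notin [:: X; Y; Z].
  move=> cXYZ; have /and5P[FX FY FZ XY YZ] := cXYZ.
  apply/negP; rewrite !inE => /or3P[] /eqP DA.
  - rewrite DA in AB nM.
    case: (chain3_up NF cXYZ FB AB) => DB.
      by move: (nU Z); rewrite FZ DB YZ.
    by move: (nM Y); rewrite FY XY DB YZ.
  - by move: (nL X); rewrite FX DA XY.
  by move: (nL Y); rewrite FY DA YZ.
have nB X Y Z : chain3 F X Y Z -> B \notin [:: X; Y; Z].
  move=> cXYZ; have /and5P[FX FY FZ XY YZ] := cXYZ.
  apply/negP; rewrite !inE => /or3P[] /eqP DB.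
  - by move: (nU Y); rewrite FY DB XY.
  - by move: (nU Z); rewrite FZ DB YZ.
  rewrite DB in AB nM.
  case: (chain3_down NF cXYZ FA AB) => DA.
    by move: (nM Y); rewrite FY YZ DA XY.
  by move: (nL X); rewrite FX DA XY.
have [/existsP[D /and3P[FD DA DB]]|/existsPn nD] :=
    boolP [exists D, [&& D \in F, D != A & D \proper B]]; last first.
  exists (B, B); apply: RepUpper => // Y FY YB; apply/eqP.
  by move: (nD Y); rewrite FY YB andbT /= negbK.
exists (A, A); apply: (RepLower (D := D)) => // Y FY AY.
have [/eqP|->|DY] // := NF D A B Y FD FA FB FY DB AB AY.
  by rewrite (negPf DA).
by move: (nM D); rewrite FD DB DY AY.
Qed.

Lemma chain3_incomparable n (F : set_family n) A B C X :
    N_avoiding F -> chain3 F A B C -> X \in F -> X \notin [:: A; B; C] ->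
  ~~ (A \subset X) && ~~ (X \subset C).
Proof.
move=> NF cABC FX; rewrite !inE !negb_or => /and3P[XA XB XC].
rewrite !subEproper [A == X]eq_sym (negPf XA) (negPf XC) /=.
apply/andP; split; apply/negP.
  by case/(chain3_up NF cABC FX) => /eqP; rewrite ?(negPf XB) ?(negPf XC).
by case/(chain3_down NF cABC FX) => /eqP; rewrite ?(negPf XA) ?(negPf XB).
Qed.

(** Since [A] is minimal in [F], [C'] lies strictly above it and is [B] or [C]; the two members [A']
    and [B'] fit below [C'] only if [C' = C] and [A' = A]. *)
Lemma chain3_ends_inj n (F : set_family n) A B C A' B' C' :
    N_avoiding F -> chain3 F A B C -> chain3 F A' B' C' -> A \subset C' ->
  (A, C) = (A', C').
Proof.
move=> NF c c' sAC'; have /and5P[FA FB FC AB BC] := c.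
have /and5P[FA' FB' FC' AB' BC'] := c'.
have irr (X : {set 'I_n}) : X \proper X -> False by rewrite properxx.
have below X : X \in F -> X \proper A -> False.
  move=> FX XA; have XC := proper_trans XA (proper_trans AB BC).
  have [DX|DX] := chain3_down NF c FX XC; rewrite DX in XA; first exact: irr XA.
  exact: irr (proper_trans AB XA).
move: sAC'; rewrite subEproper => /predU1P[DA|/(chain3_up NF c FC')].
  by rewrite -DA in BC'; case: (below B').
have belowB X : X \in F -> X \proper B -> X = A.
  move=> FX XB; have [//|DX] := chain3_down NF c FX (proper_trans XB BC).
  by rewrite DX in XB; case: (irr B).
case=> DC'; rewrite DC' in BC' *.
  have DB' := belowB _ FB' BC'; rewrite DB' in AB'.
  by case: (below A').
have [DA'|DA'] := chain3_down NF c FA' (proper_trans AB' BC'); first by rewrite DA'.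
rewrite DA' in AB'; have [DB'|DB'] := chain3_down NF c FB' BC'.
  by rewrite DB' in AB'; case: (irr A (proper_trans AB AB')).
by rewrite DB' in AB'; case: (irr B).
Qed.

(** Of two distinct comparable leaves one would be the middle of a three-chain, except when a
    lower-end leaf lies below an upper-end leaf. *)
Lemma represents_incomparable n (F : set_family n) e e' I I' :
    N_avoiding F -> e \in P2_pairs F -> e' \in P2_pairs F ->
    represents F e I -> represents F e' I' -> I.1 \subset I'.2 ->
  I = I'.
Proof.
move=> NF; rewrite !inE => /and3P[F1 F2 lt12] /and3P[F1' F2' lt12'].
case=> [A B C c _|X nX DX _|X D nX DX upX FD neD ltD];
  case=> [A' B' C' c' _|X' nX' DX' loX'|X' D' nX' DX' _ _ _ _] /= sub.
- exact: chain3_ends_inj c c' sub.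
- by have := chain3_incomparable NF c _ (nX' _ _ _ c); rewrite sub DX' F2' => /(_ isT).
- by have := chain3_incomparable NF c _ (nX' _ _ _ c); rewrite sub DX' F1' => /(_ isT).
- have := chain3_incomparable NF c' _ (nX _ _ _ c').
  by rewrite sub DX F2 andbF => /(_ isT).
- move: sub; rewrite subEproper => /predU1P[->//|XX'].
  have /nX : chain3 F e.1 X X' by rewrite /chain3 F1 DX F2 DX' F2' lt12 -DX -DX'.
  by rewrite !inE eqxx orbT.
- move: sub; rewrite subEproper => /predU1P[->//|XX'].
  have /nX : chain3 F e.1 X X' by rewrite /chain3 F1 DX F2 DX' F1' lt12 -DX -DX'.
  by rewrite !inE eqxx orbT.
- have := chain3_incomparable NF c' _ (nX _ _ _ c').
  by rewrite sub DX F1 andbF => /(_ isT).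
(* Here [X'] is the centre [e.2], which has both [X] and [D] below it, while only [e'.1] may lie
   below [X']. *)
- move: sub; rewrite subEproper => /predU1P[->//|XX'].
  have FX' : X' \in F by rewrite DX'.
  have FX : X \in F by rewrite DX.
  case/eqP: neD; rewrite (loX' X) //; apply: loX' => //.
  by rewrite (upX X').
move: sub; rewrite subEproper => /predU1P[->//|XX'].
have /nX' : chain3 F X X' e'.2 by rewrite /chain3 DX F1 DX' F1' F2' lt12' -DX -DX' XX'.
by rewrite !inE eqxx orbT.
Qed.

Lemma represents_leaf n (F : set_family n) e X :
    represents F e (X, X) ->
  (forall A B C, chain3 F A B C -> X \notin [:: A; B; C]) /\
  ((X = e.2 /\ forall Y, Y \in F -> Y \proper X -> Y = e.1) \/
   (X = e.1 /\ forall Y, Y \in F -> X \proper Y -> Y = e.2)).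
Proof.
move DI: (X, X) => I r.
case: r DI => [A B C|Y nY DY lo|Y D nY DY up _ _ _] => [|[->]|[->]]; auto.
move=> /and5P[_ _ _ AB BC] _ [DA DC].
by move: (proper_trans AB BC); rewrite -DA -DC properxx.
Qed.

(** A leaf lies in no three-chain, so it is not the upper end of one pair and the lower end of
    another; in a fixed role its partner is unique. *)
Lemma represents_leaf_inj n (F : set_family n) e e' X :
    e \in P2_pairs F -> e' \in P2_pairs F ->
    represents F e (X, X) -> represents F e' (X, X) ->
  e = e'.
Proof.
case: e e' => [A B] [A' B']; rewrite !inE => /and3P[/= FA FB AB] /and3P[/= FA' FB' AB'].
move=> /represents_leaf[nX r] /represents_leaf[_ r'].
have no3 P Q : P \in F -> Q \in F -> X \in F -> P \proper X -> X \proper Q -> False.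
  move=> FP FQ FX PX XQ; have /nX : chain3 F P X Q by apply/and5P.
  by rewrite !inE eqxx orbT.
case: r r' => [] [/= DX uX] [] [/= DX' uX'].
- by rewrite -DX (uX' A) // ?DX // -DX DX'.
- by case: (no3 A B'); rewrite // ?DX // -DX DX'.
- by case: (no3 A' B); rewrite // ?DX // -DX DX'.
by rewrite -DX (uX' B) // ?DX // -DX DX'.
Qed.

(** * Chains against pairs: the upper bound *)

(** A leaf represents one pair. The ends of a three-chain fix its middle, so they represent at most
    three pairs. These numbers match the lower bounds on the chains met. *)
Lemma card_represented_le n (F : set_family n) (I : {set 'I_n} * {set 'I_n})
    (E : {set {set 'I_n} * {set 'I_n}}) :
    3 <= n -> N_avoiding F -> E \subset P2_pairs F ->
    {in E, forall e, represents F e I} ->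
  #|E| * n`! <= chains_meeting (interval I.1 I.2) n setT * 'C(n, n./2).
Proof.
move=> n_ge3 NF /subsetP sE rE.
have [->|[e0 Ee0]] := set_0Vmem E; first by rewrite cards0.
have leaf X : {in E, forall e, represents F e (X, X)} ->
  #|E| * n`! <= chains_meeting (interval X X) n setT * 'C(n, n./2).
  move=> rX; apply: leq_trans (chains_meeting_set_ge X).
  rewrite -[X in _ <= X]mul1n leq_mul2r -(cards1 e0) subset_leq_card ?orbT //.
  apply/subsetP => e Ee; rewrite inE; apply/eqP.
  by apply: (represents_leaf_inj (sE e Ee) (sE e0 Ee0)); apply: rX.
case: (rE e0 Ee0) (rE) => [A B C c _ rAC|X _ _ _ /leaf //|X D _ _ _ _ _ _ /leaf //].
have /and5P[FA FB FC AB BC] := c.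
  apply: leq_trans (chains_meeting_chain3_ge n_ge3 AB BC).
  rewrite leq_mul2r; apply/orP; right.
have sE3 : E \subset [:: (A, B); (B, C); (A, C)].
  apply/subsetP => e Ee; move: (rAC e Ee); move DI: (A, C) => J r.
  have AC : A != C by apply: contraTneq (proper_trans AB BC) => ->; rewrite properxx.
  case: r DI => [A' B' C' c' + [DA DC]|X _ _ _ [DA DC]|X D _ _ _ _ _ _ [DA DC]].
  - rewrite -{}DA -{}DC in c' *; have /and5P[_ FB' _ AB' BC'] := c'.
    have [DB'|->] := chain3_down NF c FB' BC'; last by [].
    by rewrite DB' properxx in AB'.
  - by rewrite DA DC eqxx in AC.
  by rewrite DA DC eqxx in AC.
exact: leq_trans (subset_leq_card sE3) (card_size _).
Qed.

Lemma N_avoiding_num_P2_le n (F : set_family n) :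
  3 <= n -> N_avoiding F -> num_P2 F <= 'C(n, n./2).
Proof.
move=> n_ge3 NF.
have /choice[f rf] e : exists I, e \in P2_pairs F -> represents F e I.
  have [/(represents_exists NF)[I rI]|_] := boolP (e \in P2_pairs F).
    by exists I.
  (* Dummy value outside [P2_pairs F]. *)
  by exists e.
rewrite -(leq_pmul2r (fact_gt0 n)) -[num_P2 F]/#|P2_pairs F| -sum1_card.
rewrite (partition_big_imset f) /= big_distrl /=.
pose U I := interval I.1 I.2 : {set {set 'I_n}}.
apply: (@leq_trans
  (\sum_(I in f @: P2_pairs F) chains_meeting (U I) n setT * 'C(n, n./2))).
  apply: leq_sum => I _; rewrite sum1dep_card.
  apply: (@card_represented_le _ F) => //.
    by apply/subsetP => e; rewrite inE => /andP[].
  by move=> e; rewrite inE => /andP[Pe /eqP<-]; apply: rf.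
rewrite -big_distrl /= mulnC leq_mul2l; apply/orP; right.
apply: chains_meeting_sum_le; first by rewrite cardsT card_ord.
move=> _ _ /imsetP[e Pe ->] /imsetP[e' Pe' ->] Y Z.
rewrite !inE => /andP[eY _] /andP[_ Ze'] YZ.
apply: (represents_incomparable NF Pe Pe' (rf _ Pe) (rf _ Pe')).
exact: subset_trans eY (subset_trans YZ Ze').
Qed.

(** * The poset N and four-point paths *)

Lemma N_free_avoiding n (F : set_family n) :
  poset_free (one_poset poset_N) F -> N_avoiding F.
Proof.
move=> freeF p1 p2 q1 q2 F1 F2 G1 G2 lt11 lt21 lt22.
have [|n12] := eqVneq p1 p2; first by constructor 1.
have [|m12] := eqVneq q1 q2; first by constructor 2.
have [|n1m2] := eqVneq p1 q2; first by constructor 3.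
case: (freeF poset_N erefl).
pose f (x : N_elt) : family_poset F :=
  match x with
  | N_p1 => exist _ p1 F1 | N_p2 => exist _ p2 F2
  | N_q1 => exist _ q1 G1 | N_q2 => exist _ q2 G2
  end.
have neq (A B : {set 'I_n}) : A \proper B -> A != B.
  by apply: contraTneq => ->; rewrite properxx.
exists f; split=> [x y /(congr1 val) /eqP|].
  by case: x; case: y => //=; rewrite ?(negPf n12) ?(negPf m12) ?(negPf n1m2)
    ?(negPf (neq _ _ lt11)) ?(negPf (neq _ _ lt21)) ?(negPf (neq _ _ lt22)) // eq_sym
    ?(negPf n12) ?(negPf m12) ?(negPf n1m2)
    ?(negPf (neq _ _ lt11)) ?(negPf (neq _ _ lt21)) ?(negPf (neq _ _ lt22)).
move=> x y /predU1P[->|]; first exact: Order.POrderTheory.lexx.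
move=> ltxy; suff : val (f x) \subset val (f y) by [].
by case: x y ltxy => [] [] //= _; apply: proper_sub.
Qed.

(** The path is [p1, q1, p2, q2]; as N has no three-chain, covering is the strict order. *)
Lemma path_posets_N : path_posets 4 poset_N.
Proof.
have covE (x y : N_elt) : covered_by x y = N_lt x y.
  rewrite /covered_by -[(x < y)%O]/(N_lt x y).
  case: (boolP (N_lt x y)) => //= lt; apply/forallP => z.
  by case: x y z lt => [] [] [].
pose f (i : 'I_4) : poset_N :=
  match val i with 0 => N_p1 | 1 => N_q1 | 2 => N_p2 | _ => N_q2 end.
exists f; split; last first.
  move=> [[|[|[|[|i]]]] lti] [[|[|[|[|j]]]] ltj] //=;
    by rewrite /hasse_adj !covE.
pose g (x : poset_N) : 'I_4 :=
  match x with N_p1 => inord 0 | N_q1 => inord 1 | N_p2 => inord 2 | N_q2 => inord 3 end.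
exists g => [[[|[|[|[|i]]]] lti]|[]] //.
all: by [apply: val_inj; rewrite /= inordK | rewrite /f /= inordK].
Qed.

(** * The extremal family *)

Definition middle_star n : set_family n :=
  set0 |: [set A : {set 'I_n} | #|A| == n./2].

Lemma middle_star_proper n (A B : {set 'I_n}) :
  A \in middle_star n -> B \in middle_star n -> A \proper B -> A = set0.
Proof.
rewrite !inE => /predU1P[//|/eqP cA] /predU1P[->|/eqP cB] AB.
  by move: AB; rewrite properE sub0set andbF.
by move: (proper_card AB); rewrite cA cB ltnn.
Qed.

(** Every proper inclusion in the family starts at the empty set, but the first and last edges of a
    four-point path are disjoint. *)
Lemma middle_star_path_free n : poset_free (path_posets 4) (middle_star n).
Proof.
move=> P [f [bij_f adj_f]] [g [inj_g mono_g]].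
pose h i := val (g (f i)).
have inj_h : injective h by move=> i j /val_inj /inj_g /(bij_inj bij_f).
have bottom (i j : 'I_4) : i.+1 = j -> (h i == set0) || (h j == set0).
  move=> Dj; have : hasse_adj (f i) (f j) by rewrite adj_f Dj eqxx.
  have aux (k l : 'I_4) : k != l -> covered_by (f k) (f l) -> h k == set0.
    move=> kl /andP[/Order.POrderTheory.ltW/mono_g le_kl _].
    apply/eqP; apply: (middle_star_proper (valP (g (f k))) (valP (g (f l)))).
    by rewrite properEneq (inj_eq inj_h) kl.
  have ij : i != j by rewrite -(inj_eq val_inj) /= -Dj neq_ltn leqnn.
  case/orP => /aux -> //; first exact: orbT.
  by rewrite eq_sym.
have Hij (i j : 'I_4) : h i = set0 -> h j = set0 -> i = j.
  by move=> hi hj; apply: inj_h; rewrite hi.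
have := bottom (@Ordinal 4 0 isT) (@Ordinal 4 1 isT) erefl.
have := bottom (@Ordinal 4 2 isT) (@Ordinal 4 3 isT) erefl.
by case/orP => /eqP h2 /orP[] /eqP h1; have := Hij _ _ h1 h2.
Qed.

Lemma num_P2_middle_star n : 1 < n -> 'C(n, n./2) <= num_P2 (middle_star n).
Proof.
move=> n_gt1; rewrite -[n in 'C(n, _)]card_ord -card_draws.
have pair_inj : injective (fun A : {set 'I_n} => (set0 : {set 'I_n}, A)).
  by move=> A B [].
rewrite -(card_imset _ pair_inj).
apply: subset_leq_card; apply/subsetP => _ /imsetP[A + ->].
rewrite !inE /= eqxx /= => cA; rewrite cA orbT proper0 /=.
(* [n > 1] keeps the empty set out of the middle level. *)
by rewrite -cards_eq0 (eqP cA); lia.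
Qed.

Lemma leq_La_P2 n (PP : poset_class) (F : set_family n) :
  poset_free PP F -> num_P2 F <= La_P2 n PP.
Proof. by move=> freeF; apply: (leq_bigmax_cond F); apply/asboolP. Qed.

Theorem theorem5 (n : nat) (hn : (3 <= n)%N) :
  La_P2 n (one_poset poset_N) = La_P2 n (path_posets 4) /\
  La_P2 n (path_posets 4) = 'C(n, n./2).
Proof.
have leN : La_P2 n (one_poset poset_N) <= 'C(n, n./2).
  apply/bigmax_leqP => F /asboolP freeF.
  exact: N_avoiding_num_P2_le (N_free_avoiding freeF).
(* N is itself a four-point path, so avoiding all such paths is the stronger condition. *)
have leP : La_P2 n (path_posets 4) <= La_P2 n (one_poset poset_N).
  apply/bigmax_leqP => F /asboolP freeF; apply: leq_La_P2 => P ->.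
  exact: freeF path_posets_N.
have geP : 'C(n, n./2) <= La_P2 n (path_posets 4).
  apply: leq_trans (leq_La_P2 (@middle_star_path_free n)).
  by apply: num_P2_middle_star; lia.
by lia.
Qed.
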